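(* Let $\Sigma=(n_1,n_2,\{(E_i,A_i,B_i,C_i)\}_{i=1}^2,\{K_1,K_2\})$ be a SISO linear switched system (LSS) of order $(n_1,n_2)$ with two modes and zero initial state. Let right and left interpolation points be given as in the context, with $\ell=k$, and let $\mathcal{R}_1,\mathcal{R}_2$ and $\mathcal{O}_1,\mathcal{O}_2$ be the associated generalized controllability and observability matrices. Put $$X_1=\mathcal{R}_1,\quad X_2=\mathcal{R}_2,\quad Y_1^T=\mathcal{O}_1,\quad Y_2^T=\mathcal{O}_2,$$ and assume $\operatorname{rank}(\mathcal{R}_i)=\operatorname{rank}(\mathcal{O}_i)=k$ for $i\in\{1,2\}$. Define a reduced LSS $\hat\Sigma=(k,k,\{(\hat E_i,\hat A_i,\hat B_i,\hat C_i)\}_{i=1}^2,\{\hat K_1,\hat K_2\})$ with zero initial state, each of whose two subsystems has order $k$, by $$\hat E_i=Y_i^TE_iX_i,\quad \hat A_i=Y_i^TA_iX_i,\quad \hat B_i=Y_i^TB_i,\quad \hat C_i=C_iX_i\quad(i=1,2),$$ $$\hat K_1=Y_2^TK_1X_1,\qquad \hat K_2=Y_1^TK_2X_2.$$ Then $\hat\Sigma$ matches the data of $\Sigma$ associated with the given right and left tuples.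
   Context: **LSS with two modes.** $\Sigma$ is given by matrices $E_q,A_q\in\mathbb{R}^{n_q\times n_q}$, $B_q\in\mathbb{R}^{n_q\times 1}$, $C_q\in\mathbb{R}^{1\times n_q}$ for $q\in\{1,2\}$ ($E_q$ may be singular), and coupling matrices $K_1\in\mathbb{R}^{n_2\times n_1}$ (switching from mode 1 to mode 2) and $K_2\in\mathbb{R}^{n_1\times n_2}$ (from mode 2 to mode 1). A reduced LSS $\hat\Sigma$ has the same structure, possibly with complex entries. Write $\Phi_q(s)=(sE_q-A_q)^{-1}$. A number $s$ is an eigenvalue of the pencil $(A,E)$ if $\det(sE-A)=0$. **Generalized transfer functions.** For a word $(q_1,\dots,q_r)$ in $\{1,2\}$ with no two consecutive symbols equal, $$H_{q_1,\dots,q_r}(s_1,\dots,s_r)=C_{q_1}\Phi_{q_1}(s_1)K_{q_2}\Phi_{q_2}(s_2)K_{q_3}\cdots K_{q_r}\Phi_{q_r}(s_r)B_{q_r}.$$ $\hat H$ denotes the analogous functions of $\hat\Sigma$. **Interpolation points.** Let $m_1,\dots,m_{k^\dagger}\ge1$ with $m_1+\dots+m_{k^\dagger}=k$ and $p_1,\dots,p_{\ell^\dagger}\ge1$ with $p_1+\dots+p_{\ell^\dagger}=\ell$. The right points are $\lambda^{(i)}_1,\dots,\lambda^{(i)}_{2m_i}\in\mathbb{C}$ ($1\le i\le k^\dagger$) and the left points are $\mu^{(j)}_1,\dots,\mu^{(j)}_{2p_j}\in\mathbb{C}$ ($1\le j\le\ell^\dagger$). It is assumed that the points with odd subscript are not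 eigenvalues of $(A_1,E_1)$ and those with even subscript are not eigenvalues of $(A_2,E_2)$. **Tuples.** With $\circledcirc$ denoting concatenation of tuples: $\boldsymbol\lambda_1^{(i)}(1)=(\lambda_1^{(i)})$, $\boldsymbol\lambda_2^{(i)}(1)=(\lambda_2^{(i)})$ and, for $1<g\le m_i$, $\boldsymbol\lambda_1^{(i)}(g)=(\lambda^{(i)}_{2g-1})\circledcirc\boldsymbol\lambda_2^{(i)}(g-1)$, $\boldsymbol\lambda_2^{(i)}(g)=(\lambda^{(i)}_{2g})\circledcirc\boldsymbol\lambda_1^{(i)}(g-1)$. Likewise $\boldsymbol\mu_1^{(j)}(1)=(\mu_1^{(j)})$, $\boldsymbol\mu_2^{(j)}(1)=(\mu_2^{(j)})$ and, for $1<h\le p_j$, $\boldsymbol\mu_1^{(j)}(h)=\boldsymbol\mu_2^{(j)}(h-1)\circledcirc(\mu^{(j)}_{2h-1})$, $\boldsymbol\mu_2^{(j)}(h)=\boldsymbol\mu_1^{(j)}(h-1)\circledcirc(\mu^{(j)}_{2h})$. **Generalized controllability matrices.** $\mathcal{R}_q=[\mathcal{R}_q^{(1)},\dots,\mathcal{R}_q^{(k^\dagger)}]\in\mathbb{C}^{n_q\times k}$, where $\mathcal{R}_q^{(i)}$ has columns $r^{(i)}_{q,1},\dots,r^{(i)}_{q,m_i}$ given by $r^{(i)}_{1,1}=\Phi_1(\lambda^{(i)}_1)B_1$, $r^{(i)}_{2,1}=\Phi_2(\lambda^{(i)}_2)B_2$, and for $g\ge2$: $r^{(i)}_{1,g}=\Phi_1(\lambda^{(i)}_{2g-1})K_2r^{(i)}_{2,g-1}$,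 $r^{(i)}_{2,g}=\Phi_2(\lambda^{(i)}_{2g})K_1r^{(i)}_{1,g-1}$. **Generalized observability matrices.** $\mathcal{O}_q\in\mathbb{C}^{\ell\times n_q}$ is the vertical stack of $\mathcal{O}_q^{(1)},\dots,\mathcal{O}_q^{(\ell^\dagger)}$, where $\mathcal{O}_q^{(j)}$ has rows $o^{(j)}_{q,1},\dots,o^{(j)}_{q,p_j}$ given by $o^{(j)}_{1,1}=C_1\Phi_1(\mu^{(j)}_1)$, $o^{(j)}_{2,1}=C_2\Phi_2(\mu^{(j)}_2)$, and for $h\ge2$: $o^{(j)}_{1,h}=o^{(j)}_{2,h-1}K_1\Phi_1(\mu^{(j)}_{2h-1})$, $o^{(j)}_{2,h}=o^{(j)}_{1,h-1}K_2\Phi_2(\mu^{(j)}_{2h})$. **Matching the data.** Let $Q^{\nu,+}(g)$ (resp. $Q^{+,\nu}(g)$) be the word of length $g$ in $\{1,2\}$ with no two consecutive equal symbols that starts (resp. ends) with $\nu$. $\hat\Sigma$ matches the data of $\Sigma$ if, for all $1\le j\le\ell^\dagger$, $1\le h\le p_j$, $1\le i\le k^\dagger$, $1\le g\le m_i$ and $a\in\{1,2\}$, the following hold: - $H_{Q^{+,a}(h)}(\boldsymbol\mu_a^{(j)}(h))=\hat H_{Q^{+,a}(h)}(\boldsymbol\mu_a^{(j)}(h))$; - $H_{Q^{a,+}(g)}(\boldsymbol\lambda_a^{(i)}(g))=\hat H_{Q^{a,+}(g)}(\boldsymbol\lambda_a^{(i)}(g))$; - for $(a,b)\in\{(1,2),(2,1)\}$: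 $H_{Q^{+,a}(h)\circledcirc Q^{b,+}(g)}(\boldsymbol\mu_a^{(j)}(h)\circledcirc\boldsymbol\lambda_b^{(i)}(g))=\hat H_{Q^{+,a}(h)\circledcirc Q^{b,+}(g)}(\boldsymbol\mu_a^{(j)}(h)\circledcirc\boldsymbol\lambda_b^{(i)}(g))$. (With $\ell=k$ these are $2(k^2+2k)$ relations.)
   Formalization: It is additionally assumed that the interpolation points with odd (even) subscript are not eigenvalues of the reduced pencil of mode 1 (mode 2), so that every transfer function of the reduced system in the matching relations is defined; the rank conditions do not imply this. *)

(* Defs.v *)
From mathcomp Require Import all_boot all_order all_algebra.
From mathcomp Require Import reals complex.

Set Implicit Arguments.
Unset Strict Implicit.
Unset Printing Implicit Defensive.

Import Order.TTheory GRing.Theory Num.Theory.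

Local Open Scope ring_scope.

Variant mode := Mode1 | Mode2.

Definition other (q : mode) : mode :=
  match q with Mode1 => Mode2 | Mode2 => Mode1 end.

(* SISO linear switched systems with two modes, of order                      *)
(* (n Mode1, n Mode2). [sysK1] couples mode 1 into mode 2 and [sysK2] couples *)
(* mode 2 into mode 1. The initial state is zero, hence carries no data.      *)
Record lss (F : fieldType) (n : mode -> nat) := LSS {
  sysE : forall q, 'M[F]_(n q);
  sysA : forall q, 'M[F]_(n q);
  sysB : forall q, 'cV[F]_(n q);
  sysC : forall q, 'rV[F]_(n q);
  sysK1 : 'M[F]_(n Mode2, n Mode1);
  sysK2 : 'M[F]_(n Mode1, n Mode2)
}.

Definition map_lss (F G : fieldType) (f : F -> G) (n : mode -> nat)
    (S : lss F n) : lss G n :=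
  LSS (fun q => map_mx f (sysE S q)) (fun q => map_mx f (sysA S q))
      (fun q => map_mx f (sysB S q)) (fun q => map_mx f (sysC S q))
      (map_mx f (sysK1 S)) (map_mx f (sysK2 S)).

Definition complexify (R : realType) (n : mode -> nat) (S : lss R n) :
    lss R[i] n :=
  map_lss (real_complex R) S.

Definition pencil_eigenvalue (F : fieldType) (d : nat) (A E : 'M[F]_d) (s : F) :
    bool :=
  \det (s *: E - A) == 0.

Section Transfer.
Variables (F : fieldType) (n : mode -> nat) (S : lss F n).

(* Only meaningful when [s] is not an eigenvalue of the pencil: [invmx]       *)
(* returns its argument on singular matrices.                                 *)
Definition Phi (q : mode) (s : F) : 'M[F]_(n q) :=
  invmx (s *: sysE S q - sysA S q).

(* [coupling q q'] is the matrix K_{q'} standing between Phi_q and Phi_{q'}.  *)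
(* The value for q = q' is junk: words never repeat a symbol consecutively.   *)
Definition coupling (q q' : mode) : 'M[F]_(n q, n q') :=
  match q, q' with
  | Mode2, Mode1 => sysK1 S
  | Mode1, Mode2 => sysK2 S
  | _, _ => 0
  end.

Fixpoint transfer_col (q : mode) (s : F) (r : seq (mode * F)) : 'cV[F]_(n q) :=
  match r with
  | [::] => Phi q s *m sysB S q
  | (q', s') :: r' => Phi q s *m coupling q q' *m transfer_col q' s' r'
  end.

(* H_{w}(s), for a nonempty word w and a tuple s of the same length. *)
Definition transfer (w : seq mode) (s : seq F) : F :=
  match zip w s with
  | [::] => 0
  | (q, x) :: r => (sysC S q *m transfer_col q x r) 0 0
  end.

End Transfer.

(* The alternating word of length [g] starting with [q], and the one ending   *)
(* with [q].                                                                  *)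
Fixpoint word_from (q : mode) (g : nat) : seq mode :=
  if g is g'.+1 then q :: word_from (other q) g' else [::].

Fixpoint word_to (q : mode) (g : nat) : seq mode :=
  if g is g'.+1 then rcons (word_to (other q) g') q else [::].

(* A family of interpolation points x_1, ..., x_{2m} is encoded as a function *)
(* [x : nat -> F] of which only the values at 1, ..., 2m are ever used.       *)

(* The subscript of the [g]-th point attached to mode [q]: 2g-1 or 2g. *)
Definition subscript (q : mode) (g : nat) : nat :=
  match q with Mode1 => (2 * g - 1)%N | Mode2 => (2 * g)%N end.

Definition mode_of_subscript (t : nat) : mode :=
  if odd t then Mode1 else Mode2.

Fixpoint right_tuple (F : Type) (x : nat -> F) (q : mode) (g : nat) : seq F :=
  if g is g'.+1 then x (subscript q g) :: right_tuple x (other q) g' else [::].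

Fixpoint left_tuple (F : Type) (x : nat -> F) (q : mode) (h : nat) : seq F :=
  if h is h'.+1 then rcons (left_tuple x (other q) h') (x (subscript q h))
  else [::].

Definition admissible (F : fieldType) (n : mode -> nat) (S : lss F n)
    (kd : nat) (m : 'I_kd -> nat) (x : 'I_kd -> nat -> F) : Prop :=
  forall (i : 'I_kd) (t : nat), (1 <= t <= 2 * m i)%N ->
    ~ pencil_eigenvalue (sysA S (mode_of_subscript t))
                        (sysE S (mode_of_subscript t)) (x i t).

Section ReachObs.
Variables (F : fieldType) (n : mode -> nat) (S : lss F n).

Fixpoint ctrl_col (x : nat -> F) (q : mode) (g : nat) : 'cV[F]_(n q) :=
  match g with
  | 0 => 0
  | 1 => Phi S q (x (subscript q 1)) *m sysB S q
  | g'.+1 => Phi S q (x (subscript q g)) *m coupling S q (other q)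
               *m ctrl_col x (other q) g'
  end.

Fixpoint obs_row (x : nat -> F) (q : mode) (h : nat) : 'rV[F]_(n q) :=
  match h with
  | 0 => 0
  | 1 => sysC S q *m Phi S q (x (subscript q 1))
  | h'.+1 => obs_row x (other q) h' *m coupling S (other q) q
               *m Phi S q (x (subscript q h))
  end.

Definition ctrl_mx (kd : nat) (m : 'I_kd -> nat) (lambda : 'I_kd -> nat -> F)
    (k : nat) (hk : (\sum_i m i)%N = k) (q : mode) : 'M[F]_(n q, k) :=
  castmx (erefl (n q), hk)
    (\mxrow_i (\matrix_(a < n q, g < m i) ctrl_col (lambda i) q g.+1 a 0)).

Definition obs_mx (ld : nat) (p : 'I_ld -> nat) (mu : 'I_ld -> nat -> F)
    (l : nat) (hl : (\sum_j p j)%N = l) (q : mode) : 'M[F]_(l, n q) :=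
  castmx (hl, erefl (n q))
    (\mxcol_j (\matrix_(h < p j, a < n q) obs_row (mu j) q h.+1 0 a)).

Definition project (k : nat) (X Y : forall q, 'M[F]_(n q, k)) :
    lss F (fun _ => k) :=
  @LSS F (fun _ => k)
    (fun q => (Y q)^T *m sysE S q *m X q)
    (fun q => (Y q)^T *m sysA S q *m X q)
    (fun q => (Y q)^T *m sysB S q)
    (fun q => sysC S q *m X q)
    ((Y Mode2)^T *m sysK1 S *m X Mode1)
    ((Y Mode1)^T *m sysK2 S *m X Mode2).

End ReachObs.

Definition matches_data (F : fieldType) (n n' : mode -> nat)
    (S : lss F n) (S' : lss F n')
    (kd : nat) (m : 'I_kd -> nat) (lambda : 'I_kd -> nat -> F)
    (ld : nat) (p : 'I_ld -> nat) (mu : 'I_ld -> nat -> F) : Prop :=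
  forall (j : 'I_ld) (h : nat) (i : 'I_kd) (g : nat) (a : mode),
    (1 <= h <= p j)%N -> (1 <= g <= m i)%N ->
    let b := other a in
    [/\ transfer S (word_to a h) (left_tuple (mu j) a h)
          = transfer S' (word_to a h) (left_tuple (mu j) a h),
        transfer S (word_from a g) (right_tuple (lambda i) a g)
          = transfer S' (word_from a g) (right_tuple (lambda i) a g)
      & transfer S (word_to a h ++ word_from b g)
                   (left_tuple (mu j) a h ++ right_tuple (lambda i) b g)
          = transfer S' (word_to a h ++ word_from b g)
                   (left_tuple (mu j) a h ++ right_tuple (lambda i) b g)].

(* Main.v *)
(* Each column of R_q is determined recursively by a linear system with       *)
(* matrix s E_q - A_q. Multiplying that system by Y_q^T shows that the        *)
(* matching standard basis vector solves the corresponding reduced recursion, *)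
(* so X_q maps the reduced controllability vectors to the original ones;      *)
(* dually, Y_q^T maps the reduced observability rows to the original ones.    *)
(* All the data are products C_a r_a, o_a B_a and o_a K r_b, hence agree.     *)
Require Import Defs.
From mathcomp Require Import all_boot all_order all_algebra.
From mathcomp Require Import reals complex.
From mathcomp Require Import zify.

Set Implicit Arguments.
Unset Strict Implicit.
Unset Printing Implicit Defensive.

Import Order.TTheory GRing.Theory Num.Theory.

Local Open Scope ring_scope.

(** A column of [R_q] is [X_q e] with [e] a basis vector, and solves [(s E_q - A_q) X_q e = v],
    where [v] is [B_q] or a coupling times the preceding column. Multiplying by [Y_q^T] gives the
    reduced pencil times [e] equal to [Y_q^T v], the right-hand side of the reduced recursion. The
    reduced pencil is invertible at the points, so [e] is the reduced column ([project_ctrl_col],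
    dually [project_obs_row]). Hence [o K r] is the reduced row times [Y^T K X] times the reduced
    column, and [Y^T K X] is the reduced coupling. *)

Section DataAsProducts.
Variables (F : fieldType) (n : mode -> nat) (S : lss F n).

Definition transfer_pairs (z : seq (mode * F)) : F :=
  match z with
  | [::] => 0
  | (q, x) :: r => (sysC S q *m transfer_col S q x r) 0 0
  end.

(* The factor to the right of Phi_q in a product whose remaining part is [r]. *)
Definition transfer_tail (q : mode) (r : seq (mode * F)) : 'cV[F]_(n q) :=
  match r with
  | [::] => sysB S q
  | (q', x) :: r' => coupling S q q' *m transfer_col S q' x r'
  end.

Lemma transferE w s : transfer S w s = transfer_pairs (zip w s).
Proof. by []. Qed.

Lemma transfer_colE q x r :
  transfer_col S q x r = Phi S q x *m transfer_tail q r.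
Proof. by case: r => [|[q' y] r] //=; rewrite mulmxA. Qed.

Lemma size_word_to q h : size (word_to q h) = h.
Proof. by elim: h q => //= h IH q; rewrite size_rcons IH. Qed.

Lemma size_left_tuple (x : nat -> F) q h : size (left_tuple x q h) = h.
Proof. by elim: h q => //= h IH q; rewrite size_rcons IH. Qed.

(** Left words grow at their end while [transfer_col] recurses from the front; with [r] arbitrary,
    the last letter can be moved into [r] in the induction. *)
Lemma transfer_pairs_left (x : nat -> F) q h r :
  transfer_pairs (zip (word_to q h.+1) (left_tuple x q h.+1) ++ r) =
  (obs_row S x q h.+1 *m transfer_tail q r) 0 0.
Proof.
elim: h q r => [|h IH] q r; first by rewrite /= transfer_colE mulmxA.
rewrite [word_to q _]/= [left_tuple x q _]/= zip_rcons; last first.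
  by rewrite !size_rcons size_word_to size_left_tuple.
by rewrite cat_rcons IH /= transfer_colE !mulmxA.
Qed.

Lemma transfer_col_right (x : nat -> F) q g :
  transfer_col S q (x (subscript q g.+1))
    (zip (word_from (other q) g) (right_tuple x (other q) g)) =
  ctrl_col S x q g.+1.
Proof. by elim: g q => //= g IH q; rewrite IH. Qed.

Lemma transfer_left (x : nat -> F) q h :
  transfer S (word_to q h.+1) (left_tuple x q h.+1) =
  (obs_row S x q h.+1 *m sysB S q) 0 0.
Proof. by rewrite transferE -[zip _ _]cats0 transfer_pairs_left. Qed.

Lemma transfer_right (x : nat -> F) q g :
  transfer S (word_from q g.+1) (right_tuple x q g.+1) =
  (sysC S q *m ctrl_col S x q g.+1) 0 0.
Proof. by rewrite -transfer_col_right. Qed.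

Lemma transfer_left_right (x y : nat -> F) q q' h g :
  transfer S (word_to q h.+1 ++ word_from q' g.+1)
             (left_tuple x q h.+1 ++ right_tuple y q' g.+1) =
  (obs_row S x q h.+1 *m coupling S q q' *m ctrl_col S y q' g.+1) 0 0.
Proof.
rewrite transferE zip_cat ?size_word_to ?size_left_tuple //.
by rewrite transfer_pairs_left -transfer_col_right mulmxA.
Qed.

Lemma ctrl_colS (x : nat -> F) q g :
  ctrl_col S x q g.+2 = Phi S q (x (subscript q g.+2)) *m
    (coupling S q (other q) *m ctrl_col S x (other q) g.+1).
Proof. by rewrite mulmxA. Qed.

Lemma obs_rowS (x : nat -> F) q h :
  obs_row S x q h.+2 = obs_row S x (other q) h.+1 *m coupling S (other q) q
    *m Phi S q (x (subscript q h.+2)).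
Proof. by []. Qed.

Lemma ctrl_mx_col (kd : nat) (m : 'I_kd -> nat) (lambda : 'I_kd -> nat -> F)
    (k : nat) (hk : (\sum_i m i)%N = k) i g :
  (g < m i)%N -> exists e : 'cV[F]_k,
    forall q, ctrl_mx S lambda hk q *m e = ctrl_col S (lambda i) q g.+1.
Proof.
move=> lt_g; case: k / hk; pose j := tagnat.Rank i (Ordinal lt_g).
exists (delta_mx j 0) => q; rewrite /ctrl_mx castmx_id -colE.
(* The position inside block [i] is recovered up to a transport along an equality of block indices,
   which is destructed here. *)
by apply/colP=> a; rewrite !mxE tagnat.Rank2K; case: _ / esym.
Qed.

Lemma obs_mx_row (ld : nat) (p : 'I_ld -> nat) (mu : 'I_ld -> nat -> F)
    (l : nat) (hl : (\sum_j p j)%N = l) j h :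
  (h < p j)%N -> exists e : 'rV[F]_l,
    forall q, e *m obs_mx S mu hl q = obs_row S (mu j) q h.+1.
Proof.
move=> lt_h; case: l / hl; pose i := tagnat.Rank j (Ordinal lt_h).
exists (delta_mx 0 i) => q; rewrite /obs_mx castmx_id -rowE.
by apply/rowP=> a; rewrite !mxE tagnat.Rank2K; case: _ / esym.
Qed.

(** With [g] counted from 0 the subscript is 2g+1 or 2g+2: its parity gives back the mode, and
    [g < m i] keeps it at most 2 m_i. *)
Lemma admissible_unitmx (kd : nat) (m : 'I_kd -> nat)
    (x : 'I_kd -> nat -> F) q i g :
  admissible S m x -> (g < m i)%N ->
  x i (subscript q g.+1) *: sysE S q - sysA S q \in unitmx.
Proof.
move=> adm lt_g; rewrite unitmxE unitfE.
have mode_q : mode_of_subscript (subscript q g.+1) = q.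
  by case: q; rewrite /mode_of_subscript /subscript mul2n doubleS ?subn1 /=
    odd_double.
have /adm : (1 <= subscript q g.+1 <= 2 * m i)%N.
  by case: q {mode_q} => /=; lia.
by rewrite mode_q => /negP.
Qed.

End DataAsProducts.

Section Projection.
Variables (F : fieldType) (n : mode -> nat) (S : lss F n).
Variables (k : nat) (X Y : forall q, 'M[F]_(n q, k)).
Let S' := project S X Y.

Lemma project_pencil q s :
  s *: sysE S' q - sysA S' q = (Y q)^T *m (s *: sysE S q - sysA S q) *m X q.
Proof. by rewrite mulmxBr mulmxBl -scalemxAr -scalemxAl. Qed.

Lemma project_coupling q q' :
  coupling S' q q' = (Y q)^T *m coupling S q q' *m X q'.
Proof. by case: q; case: q'; rewrite //= mulmx0 mul0mx. Qed.

Lemma project_ctrl_col (kd : nat) (m : 'I_kd -> nat)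
    (lambda : 'I_kd -> nat -> F) (sum_m : (\sum_i m i)%N = k) i g q :
  (forall q, X q = ctrl_mx S lambda sum_m q) ->
  admissible S m lambda -> admissible S' m lambda -> (g < m i)%N ->
  X q *m ctrl_col S' (lambda i) q g.+1 = ctrl_col S (lambda i) q g.+1.
Proof.
move=> defX adm adm'.
(* Leaving [v] free treats the input [B] and the coupled preceding column alike. *)
have step q1 g1 (v : 'cV_(n q1)) : (g1 < m i)%N ->
    ctrl_col S (lambda i) q1 g1.+1 =
      Phi S q1 (lambda i (subscript q1 g1.+1)) *m v ->
    X q1 *m (Phi S' q1 (lambda i (subscript q1 g1.+1)) *m ((Y q1)^T *m v)) =
      ctrl_col S (lambda i) q1 g1.+1.
  move=> lt_g1 eq_col; have [e eX] := ctrl_mx_col S lambda sum_m lt_g1.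
  have eX1 := eX q1; rewrite -defX in eX1.
  have pencil_e : (lambda i (subscript q1 g1.+1) *: sysE S' q1 - sysA S' q1)
      *m e = (Y q1)^T *m v.
    by rewrite project_pencil -!mulmxA eX1 eq_col
    mulKVmx ?(admissible_unitmx q1 adm).
  by rewrite -pencil_e mulKmx ?eX1 ?(admissible_unitmx q1 adm').
elim: g q => [|g IH] q lt_g; first exact: step.
(* Here [v] is the coupling times the preceding column, which the induction hypothesis writes as [X]
   times the reduced one. *)
rewrite -[RHS](step q g.+1 _ lt_g (ctrl_colS _ _ _ _)) ctrl_colS.
by rewrite project_coupling -!mulmxA IH // ltnW.
Qed.

Lemma project_obs_row (ld : nat) (p : 'I_ld -> nat)
    (mu : 'I_ld -> nat -> F) (sum_p : (\sum_j p j)%N = k) j h q :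
  (forall q, (Y q)^T = obs_mx S mu sum_p q) ->
  admissible S p mu -> admissible S' p mu -> (h < p j)%N ->
  obs_row S' (mu j) q h.+1 *m (Y q)^T = obs_row S (mu j) q h.+1.
Proof.
move=> defY adm adm'.
have step q1 h1 (v : 'rV_(n q1)) : (h1 < p j)%N ->
    obs_row S (mu j) q1 h1.+1 =
      v *m Phi S q1 (mu j (subscript q1 h1.+1)) ->
    v *m X q1 *m Phi S' q1 (mu j (subscript q1 h1.+1)) *m (Y q1)^T =
      obs_row S (mu j) q1 h1.+1.
  move=> lt_h1 eq_row; have [e eY] := obs_mx_row S mu sum_p lt_h1.
  have eY1 := eY q1; rewrite -defY in eY1.
  have pencil_e : e *m (mu j (subscript q1 h1.+1) *: sysE S' q1 - sysA S' q1)
      = v *m X q1.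
    by rewrite project_pencil !mulmxA eY1 eq_row
    mulmxKV ?(admissible_unitmx q1 adm).
  by rewrite -pencil_e mulmxK ?eY1 ?(admissible_unitmx q1 adm').
elim: h q => [|h IH] q lt_h; first exact: step.
rewrite -[RHS](step q h.+1 _ lt_h (obs_rowS _ _ _ _)) obs_rowS.
by rewrite project_coupling !mulmxA IH // ltnW.
Qed.

End Projection.

Theorem lemma4p1 (R : realType) (n : mode -> nat) (Sigma : lss R n)
    (k kd ld : nat) (m : 'I_kd -> nat) (p : 'I_ld -> nat)
    (m_gt0 : forall i, (1 <= m i)%N) (p_gt0 : forall j, (1 <= p j)%N)
    (sum_m : (\sum_i m i)%N = k) (sum_p : (\sum_j p j)%N = k)
    (lambda : 'I_kd -> nat -> R[i]) (mu : 'I_ld -> nat -> R[i])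
    (lambda_adm : admissible (complexify Sigma) m lambda)
    (mu_adm : admissible (complexify Sigma) p mu)
    (X Y : forall q, 'M[R[i]]_(n q, k))
    (defX : forall q, X q = ctrl_mx (complexify Sigma) lambda sum_m q)
    (defY : forall q, (Y q)^T = obs_mx (complexify Sigma) mu sum_p q)
    (rank_ctrl : forall q,
       \rank (ctrl_mx (complexify Sigma) lambda sum_m q) = k)
    (rank_obs : forall q,
       \rank (obs_mx (complexify Sigma) mu sum_p q) = k)
    (lambda_adm_red : admissible (project (complexify Sigma) X Y) m lambda)
    (mu_adm_red : admissible (project (complexify Sigma) X Y) p mu) :
  matches_data (complexify Sigma) (project (complexify Sigma) X Y)
               m lambda p mu.
Proof.
(* The bounds exclude length 0, where the rows and columns take the default value 0. *)
move=> j [|h] i [|g] a // lt_h lt_g b.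
have oY q := project_obs_row q defY mu_adm mu_adm_red lt_h.
have Xr q := project_ctrl_col q defX lambda_adm lambda_adm_red lt_g.
split.
- by rewrite !transfer_left -oY -mulmxA.
- by rewrite !transfer_right -Xr mulmxA.
- by rewrite !transfer_left_right -oY -Xr project_coupling !mulmxA.
Qed.
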